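(* Let $B$ and $B_q$ be topological (boundary) spaces, let $q:B\to B_q$ be a continuous surjection and quotient map, and let $\{\omega_x^D:x\in D\}$ be a harmonic measure on $B$, indexed by a domain $D$. Define $\omega_x^{D,q}:=q_\#\omega_x^D$ for $x\in D$. Then $\{\omega_x^{D,q}:x\in D\}$ is a harmonic measure on $B_q$. If $\{\omega_x^D\}$ is continuous, then so is $\{\omega_x^{D,q}\}$. More precisely, for every $x\in D$ and every $\omega_x^{D,q}$-integrable function $\varphi$ on $B_q$, $$\int_{B_q}\varphi\,d\omega_x^{D,q}=\int_B\varphi\circ q\,d\omega_x^D.$$
   Context: A domain is a nonempty connected open subset of a first-countable Hausdorff space. A harmonic measure on a topological space $B$, indexed by $D$, is a family $\{\omega_x^D:x\in D\}$ of positive Borel measures on $B$ (completed when integrable functions are considered) such that $\omega_x^D(B)=1$ and $\omega_x^D\ll\omega_y^D$ for all $x,y\in D$. It is continuous if $x\mapsto\int_Bf\,d\omega_x^D$ is continuous on $D$ for every $f\in\bigcap_{x\in D}L^1(B,\omega_x^D)$. The push-forward is $q_\#\mu(A)=\mu(q^{-1}(A))$. *)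

(* Defs.v *)
From HB Require Import structures.
From mathcomp Require Import all_boot all_order all_algebra.
From mathcomp Require Import all_classical all_reals all_analysis.
From mathcomp Require Import measurable_realfun.

Set Implicit Arguments.
Unset Strict Implicit.
Unset Printing Implicit Defensive.

Import Order.TTheory GRing.Theory Num.Theory.
Import numFieldNormedType.Exports.

Local Open Scope classical_set_scope.
Local Open Scope ring_scope.
Local Open Scope ereal_scope.

Definition first_countable (X : topologicalType) :=
  forall x : X, exists U : set (set X),
    [/\ countable U, U `<=` nbhs x &
        forall V, nbhs x V -> exists2 W, U W & W `<=` V].

Definition is_domain (X : topologicalType) (D : set X) :=
  [/\ D !=set0, connected D & open D].

Definition quotient_map (B C : topologicalType) (q : B -> C) :=
  set_surj [set: B] [set: C] q /\
  forall V : set C, open V <-> open (q @^-1` V).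

(* Measurable spaces are pointed in the library, hence [ptopologicalType]; the
   point is never used. *)
Notation borel B := (g_sigma_algebraType (@open B)).

(* The carrier of mu with the sigma-algebra of the sets A `|` N, A measurable and
   N contained in a measurable null set (see [completion_measurableE]). *)
Notation completion mu := (g_sigma_algebraType (completed_algebra_gen mu)).

(* A `|` N is sent to mu A, which does not depend on the decomposition (see
   [completed_measureE]); sets outside the completed sigma-algebra get 0. *)
Definition completed_measure d (T : measurableType d) (R : realType)
    (mu : set T -> \bar R) : set (completion mu) -> \bar R :=
  fun E => mu (xget set0 [set A : set T | measurable A /\
                            exists2 N, mu.-negligible N & A `|` N = E]).
Arguments completed_measure {d T R} mu.

Section completion_theory.
Context d (T : measurableType d) (R : realType).
Variable mu : {measure set T -> \bar R}.

Lemma completion_measurableE :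
  (measurable : set (set (completion mu))) = completed_algebra_gen mu.
Proof.
apply/seteqP; split; last first.
  by move=> A ?; exact: (@sub_sigma_algebra _ setT (completed_algebra_gen mu)).
apply: smallest_sub => //=; split => /=.
- by exists set0 => //; exists set0; [exact: negligible_set0|rewrite setU0].
- move=> _ [A /= mA [N [F [mF F0 NF]] <-]]; rewrite setTD.
  exists (~` A `&` ~` F).
    by apply: measurableI; exact: measurableC.
  exists ((F `&` ~` A) `\` N).
    by exists F; split => // x [[]].
  apply/seteqP; split => [x [[nA nF] [//|/NF//]|[[_ nA] nN] []//]|x nAN].
  have nA : ~ A x by move=> ?; apply: nAN; left.
  have nN : ~ N x by move=> ?; apply: nAN; right.
  by have [Fx|nFx] := pselect (F x); [right|left].
- move=> F mF /=.
  pose A n := projT1 (cid2 (mF n)).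
  pose N n := projT1 (cid2 (projT2 (cid2 (mF n))).2).
  exists (\bigcup_k A k).
    by apply: bigcupT_measurable => i; rewrite /A; case: cid2.
  exists (\bigcup_k N k).
    apply: negligible_bigcup => /= k.
    by rewrite /N; case: (cid2 (mF k)) => //= *; case: cid2.
  rewrite -bigcupU; apply: eq_bigcup => // i _.
  by rewrite /A /N; case: (cid2 (mF i)) => //= *; case: cid2.
Qed.

Lemma completed_measureE (A N : set T) : measurable A -> mu.-negligible N ->
  completed_measure mu (A `|` N) = mu A.
Proof.
have le_mu (A1 N1 A2 N2 : set T) : measurable A1 -> measurable A2 ->
    mu.-negligible N2 -> A1 `|` N1 = A2 `|` N2 -> mu A1 <= mu A2.
  move=> mA1 mA2 [F [mF F0 NF]] E.
  apply: (@le_trans _ _ (mu (A2 `|` F))).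
    apply: le_measure; rewrite ?inE//; first exact: measurableU.
    have : A1 `<=` A2 `|` N2 by rewrite -E; exact: subsetUl.
    by move=> s; apply: (subset_trans s); exact: setUS.
  have le_muU := measureU2 mu mA2 mF.
  by apply: (le_trans le_muU); rewrite [X in _ + X](_ : _ = 0)// adde0.
move=> mA nN; rewrite /completed_measure.
case: xgetP => [C _ [mC [M nM CM]]|/(_ A)[]]; last by split => //; exists N.
by apply/eqP; rewrite eq_le (le_mu _ M _ N)//= (le_mu _ N _ M).
Qed.

Let completed_measure0 : completed_measure mu set0 = 0.
Proof.
by rewrite -(setU0 set0) completed_measureE//; exact: negligible_set0.
Qed.

Let completed_measure_ge0 E : 0 <= completed_measure mu E.
Proof. exact: measure_ge0. Qed.

Let completed_measure_sigma_additive :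
  semi_sigma_additive (completed_measure mu).
Proof.
move=> F mF tF _.
have {}mF n : completed_algebra_gen mu (F n).
  by rewrite -completion_measurableE; exact: mF.
pose A n := projT1 (cid2 (mF n)).
pose N n := projT1 (cid2 (projT2 (cid2 (mF n))).2).
have mA n : measurable (A n) by rewrite /A; case: cid2.
have nN n : mu.-negligible (N n).
  by rewrite /N; case: (cid2 (mF n)) => //= *; case: cid2.
have AN n : A n `|` N n = F n.
  by rewrite /A /N; case: (cid2 (mF n)) => //= *; case: cid2.
have -> : \bigcup_n F n = (\bigcup_n A n) `|` (\bigcup_n N n).
  by rewrite -bigcupU; apply: eq_bigcup => // n _; rewrite AN.
rewrite completed_measureE; [|exact: bigcupT_measurable|
  exact: negligible_bigcup].
under eq_fun do under eq_bigr do rewrite -AN completed_measureE//.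
apply: measure_semi_sigma_additive => //; last exact: bigcupT_measurable.
move=> i j Di Dj [z [Ai Aj]]; apply: tF => //; exists z.
by rewrite -!AN; split; left.
Qed.

HB.instance Definition _ := isMeasure.Build _ _ _ (completed_measure mu)
  completed_measure0 completed_measure_ge0 completed_measure_sigma_additive.

End completion_theory.

(* Values of omega x at x outside D are irrelevant. *)
Definition harmonic_measure (R : realType) (X : topologicalType) (D : set X)
    (B : ptopologicalType) (omega : X -> set (borel B) -> \bar R) :=
  [/\ forall x, D x ->
        exists mu : {measure set (borel B) -> \bar R}, omega x = mu,
      forall x, D x -> omega x [set: borel B] = 1 &
      forall x y, D x -> D y -> omega x `<< omega y].

Definition completed_integrable d (T : measurableType d) (R : realType)
    (mu : set T -> \bar R) (f : T -> \bar R) : Prop :=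
  (completed_measure mu).-integrable [set: completion mu] f.

Definition completed_integral d (T : measurableType d) (R : realType)
    (mu : set T -> \bar R) (f : T -> \bar R) : \bar R :=
  \int[completed_measure mu]_(b in [set: completion mu]) f b.

Definition continuous_harmonic_measure (R : realType) (X : topologicalType)
    (D : set X) (B : ptopologicalType) (omega : X -> set (borel B) -> \bar R) :=
  forall f : B -> \bar R,
    (forall x, D x -> completed_integrable (omega x) f) ->
    {within D, continuous (fun x => completed_integral (omega x) f)}.

(* Main.v *)
Require Import Defs.
From HB Require Import structures.
From mathcomp Require Import all_boot all_order all_algebra.
From mathcomp Require Import all_classical all_reals all_analysis.
From mathcomp Require Import measurable_realfun.

Set Implicit Arguments.
Unset Strict Implicit.
Unset Printing Implicit Defensive.

Import Order.TTheory GRing.Theory Num.Theory.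
Import numFieldNormedType.Exports.

Local Open Scope classical_set_scope.
Local Open Scope ring_scope.
Local Open Scope ereal_scope.

(** Two facts carry the proof.

    First, a continuous map is Borel measurable, because preimages commute with
    the operations that generate a sigma-algebra.  The push-forward of a
    measure along a measurable map is a measure of the same total mass, and a
    measurable set is null for the push-forward exactly when its preimage is
    null for the original measure; so mutual absolute continuity is preserved
    ([pushforward_null_dominates]).

    Second, completion commutes with push-forward on the sets measurable for
    the completed push-forward.  Such a set has the form [A `|` N], with [A]
    Borel and [N] inside a null set; its preimage is the union of a Borel set
    and a subset of a null set, since the preimage of a null set is null
    ([completed_pushforward_preimage]).  Hence the map stays measurable
    between the completed spaces ([measurable_fun_completion]), and on these
    sets the completed push-forward agrees with the push-forward of the
    completed measure ([completed_pushforwardE]).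

    The integral formula is then the usual change of variables, applied to the
    completed measures ([completed_integral_pushforward]).  Continuity follows
    from it: if [phi] is integrable for every pushed measure, then [phi \o q]
    is integrable for every original one, and the two functions of [x] given by
    the integrals agree on the domain. *)

Lemma continuous_borel_measurable (B C : ptopologicalType) (q : B -> C) :
  continuous q ->
  measurable_fun [set: borel B] (q : borel B -> borel C).
Proof.
move=> /continuousP qc.
apply: (@measurability _ _ (borel B) (borel C) _ _ (@open C)) => //.
move=> _ [V oV <-]; rewrite setTI.
by apply: sub_sigma_algebra; exact: qc.
Qed.

(** The set function [pushforward mu f] is bundled as a measure only through a
    proof that [f] is measurable.  The equation with a bundled measure [nu] lets
    a goal be rewritten from [pushforward mu f] to [nu] everywhere at once,
    including inside the type [completion (pushforward mu f)]. *)
Lemma pushforward_is_measure d d' (T : measurableType d) (U : measurableType d')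
    (R : realType) (mu : {measure set T -> \bar R}) (f : T -> U) :
  measurable_fun [set: T] f ->
  exists nu : {measure set U -> \bar R}, pushforward mu f = nu.
Proof.
move=> mf; by unshelve eexists; first exact:
  (measure_function_pushforward__canonical__measure_function_Measure mu mf).
Qed.

Section pushforward_completion.
Context d d' (T : measurableType d) (U : measurableType d') (R : realType).
Variable f : T -> U.
Hypothesis mf : measurable_fun [set: T] f.
Implicit Types mu : {measure set T -> \bar R}.

Let mpre (A : set U) : measurable A -> measurable (f @^-1` A).
Proof. by move=> mA; rewrite -[X in measurable X]setTI; exact: mf. Qed.

Lemma pushforward_null_dominates mu1 mu2 :
  mu1 `<< mu2 -> pushforward mu1 f `<< pushforward mu2 f.
Proof.
move=> mu12 N nullN A mA AN.
apply: (mu12 (f @^-1` A)) => //; last exact: mpre.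
by apply/measure0_null_setP; [exact: mpre|exact: nullN].
Qed.

Lemma negligible_preimage mu (N : set U) :
  (pushforward mu f).-negligible N -> mu.-negligible (f @^-1` N).
Proof.
move=> [F [mF F0 NF]]; exists (f @^-1` F); split => //; first exact: mpre.
exact: preimage_subset.
Qed.

(** Adding a negligible set changes neither side: if [E] is [A `|` N], its
    preimage is [f @^-1` A `|` f @^-1` N] with [f @^-1` N] negligible, so both
    completed measures equal [mu (f @^-1` A)]. *)
Lemma completed_pushforward_preimage mu (E : set U) :
  measurable (E : set (completion (pushforward mu f))) ->
  measurable (f @^-1` E : set (completion mu)) /\
  completed_measure (pushforward mu f) E = completed_measure mu (f @^-1` E).
Proof.
have [nu nuE] := pushforward_is_measure mu mf.
move: (@negligible_preimage mu); rewrite nuE (completion_measurableE nu) => npre.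
move=> [A mA [N nN <-]]; have nfN := npre _ nN; split.
  rewrite completion_measurableE; exists (f @^-1` A); first exact: mpre.
  by exists (f @^-1` N).
rewrite preimage_setU !completed_measureE//; last exact: mpre.
by rewrite -nuE.
Qed.

Lemma measurable_fun_completion mu :
  measurable_fun [set: completion mu]
    (f : completion mu -> completion (pushforward mu f)).
Proof.
move=> _ E mE; rewrite setTI.
by have [] := completed_pushforward_preimage mE.
Qed.

Lemma completed_pushforwardE mu (E : set U) :
  measurable (E : set (completion (pushforward mu f))) ->
  completed_measure (pushforward mu f) E =
  pushforward (completed_measure mu)
    (f : completion mu -> completion (pushforward mu f)) E.
Proof. by move=> /completed_pushforward_preimage[]. Qed.

(** The two set functions may differ on sets outside the completed
    sigma-algebra of the push-forward, where one of them is [0] by convention;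
    an integral only sees measurable sets. *)
Lemma integral_completed_pushforward mu (phi : U -> \bar R) :
  \int[completed_measure (pushforward mu f)]_(y in
      [set: completion (pushforward mu f)]) phi y =
  \int[pushforward (completed_measure mu)
        (f : completion mu -> completion (pushforward mu f))]_(y in
      [set: completion (pushforward mu f)]) phi y.
Proof.
have [nu nuE] := pushforward_is_measure mu mf.
have := @completed_pushforwardE mu; have := @measurable_fun_completion mu.
rewrite nuE => mfc eqm.
have [la laE] := @pushforward_is_measure _ _ (completion mu) _ _
  (completed_measure mu) _ mfc.
rewrite laE; apply: eq_measure_integral => E mE _.
by rewrite /= -laE; exact: eqm.
Qed.

(** Integrability of [phi \o f] has to come first: the change of variables for
    signed functions assumes it, while the one for [`|phi|] only needs
    measurability and so transfers the finiteness of the integral. *)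
Lemma completed_integral_pushforward mu (phi : U -> \bar R) :
  completed_integrable (pushforward mu f) phi ->
  completed_integrable mu (phi \o f) /\
  completed_integral (pushforward mu f) phi = completed_integral mu (phi \o f).
Proof.
move=> /integrableP[mphi intphi].
have mfc := @measurable_fun_completion mu.
have iphif : completed_integrable mu (phi \o f).
  apply/integrableP; split; first exact: (measurableT_comp mphi mfc).
  move: intphi; rewrite integral_completed_pushforward.
  by rewrite (ge0_integral_pushforward mfc)//; exact: measurableT_comp.
split => //.
rewrite /completed_integral integral_completed_pushforward.
exact: (integral_pushforward mfc).
Qed.

End pushforward_completion.

Theorem proposition4p13 (R : realType)
    (X : topologicalType) (X_first_countable : first_countable X)
    (X_hausdorff : hausdorff_space X)
    (D : set X) (D_domain : is_domain D)
    (B Bq : ptopologicalType) (q : B -> Bq)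
    (q_continuous : continuous q)
    (q_surjective : set_surj [set: B] [set: Bq] q)
    (q_quotient : quotient_map q)
    (omega : X -> set (borel B) -> \bar R)
    (omega_harmonic : harmonic_measure D omega) :
  let omegaq : X -> set (borel Bq) -> \bar R :=
    fun x => pushforward (omega x) (q : borel B -> borel Bq) in
  [/\ harmonic_measure D omegaq,
      continuous_harmonic_measure D omega ->
        continuous_harmonic_measure D omegaq &
      forall x, D x -> forall phi : Bq -> \bar R,
        completed_integrable (omegaq x) phi ->
        completed_integrable (omega x) (phi \o q) /\
        completed_integral (omegaq x) phi =
          completed_integral (omega x) (phi \o q)].
Proof.
move=> omegaq.
have [omega_measure omega1 omega_dom] := omega_harmonic.
have mq := continuous_borel_measurable q_continuous.
have intq x : D x -> forall phi : Bq -> \bar R,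
    completed_integrable (omegaq x) phi ->
    completed_integrable (omega x) (phi \o q) /\
    completed_integral (omegaq x) phi = completed_integral (omega x) (phi \o q).
  move=> Dx phi; rewrite /omegaq; have [mu ->] := omega_measure _ Dx.
  exact: (completed_integral_pushforward mq).
split => //.
- split => [x Dx|x Dx|x y Dx Dy].
  + rewrite /omegaq; have [mu ->] := omega_measure _ Dx.
    exact: (pushforward_is_measure mu mq).
  + by rewrite /omegaq /pushforward preimage_setT omega1.
  + have := omega_dom _ _ Dx Dy; rewrite /omegaq.
    have [mu1 ->] := omega_measure _ Dx; have [mu2 ->] := omega_measure _ Dy.
    exact: pushforward_null_dominates.
- move=> omega_cont phi phi_int.
  have phiq_cont : {within D, continuous
      (fun x => completed_integral (omega x) (phi \o q))}.
    by apply: omega_cont => x Dx; have [] := intq x Dx phi (phi_int x Dx).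
  apply: subspace_eq_continuous phiq_cont => x /set_mem Dx.
  by rewrite /from_subspace; have [_ ->] := intq x Dx phi (phi_int x Dx).
Qed.
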